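(* Fix $p\in(0,1)$. For each $n$, let $(\xi_{ij})_{i,j\in[n]}$ be i.i.d. Bernoulli$(p)$ random variables (the biadjacency matrix of a bipartite Erdős–Rényi graph with $n+n$ vertices), and let $$H_n:=\frac{1}{p^n\,n!}\sum_{\sigma\in S_n}\prod_{i=1}^n\xi_{i\sigma(i)}$$ be the normalized number of perfect matchings. Then, as $n\to\infty$, $H_n$ converges weakly to $\exp(X)$ with $X\sim\mathcal N\big(-\tfrac{1-p}{2p},\tfrac{1-p}{p}\big)$, i.e. to the lognormal distribution with parameters $-\frac{1-p}{2p}$ and $\frac{1-p}{p}$.
   Context: $S_n$ is the symmetric group on $[n]=\{1,\dots,n\}$. $\mathcal N(a,s^2)$ is the normal law with mean $a$ and variance $s^2$. *)

(* Defs.v *)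
From HB Require Import structures.
From mathcomp Require Import all_boot all_order all_algebra all_fingroup.
From mathcomp Require Import all_classical all_reals all_analysis.
Set Implicit Arguments. Unset Strict Implicit. Unset Printing Implicit Defensive.
Import Order.TTheory GRing.Theory Num.Theory.
Local Open Scope ring_scope.

(* A realization of the n x n Bernoulli matrix (xi_ij): a boolean matrix. *)
Definition bmatrix (n : nat) := {ffun 'I_n * 'I_n -> bool}.

Definition bern_weight {R : realType} (p : R) (n : nat) (xi : bmatrix n) : R :=
  \prod_(k : 'I_n * 'I_n) (if xi k then p else 1 - p).

Definition Hn {R : realType} (p : R) (n : nat) (xi : bmatrix n) : R :=
  (p ^+ n * (n`!)%:R)^-1 *
  \sum_(s : 'S_n) \prod_(i < n) ((xi (i, s i))%:R : R).

Definition expect_f_Hn {R : realType} (p : R) (n : nat) (f : R -> R) : R :=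
  \sum_(xi : bmatrix n) bern_weight p xi * f (Hn p xi).

(* Main.v *)
Require Import Defs.
From HB Require Import structures.
From mathcomp Require Import all_boot all_order all_algebra all_fingroup.
From mathcomp Require Import all_classical all_reals all_analysis.
From mathcomp Require Import measurable_realfun ring lra.
Import Order.TTheory GRing.Theory Num.Theory.
Import numFieldNormedType.Exports.
Local Open Scope ring_scope.

(* Let q = (1 - p) / p, eta_ij = xi_ij / p - 1 (centred, of variance q) and
   S = (1/n) \sum_ij eta_ij. Both H and G = exp (S - q / 2) have explicit second
   moments: E H^2 = \sum_(k <= n) q^k / k! (an average of (1 + q)^(number of fixed
   points) over permutations), while E (H G) and E G^2 factorize over the
   entries. All three tend to e^q, so E (H - G)^2 tends to 0, and it remains to
   prove the central limit theorem for S. Replacing the entries of S one by one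
   by Gaussian increments (Lindeberg), with a heat kernel as test function, gives
   pointwise convergence of the density of S plus a small Gaussian noise; by
   Scheffe's lemma this density converges in L^1, and the noise is removed at
   the end. *)

(** * Moments of the permanent and of the exponential of the sum of entries *)

(** Each pair (i, j) lies on the graph of a fraction 1/n of the permutations, so S is exactly the
    first-order term of H when the products of the 1 + eta_ij are expanded; the shift - q / 2 makes
    E G tend to 1 = E H. Controlling the higher-order terms of H one by one would mean handling sums
    over all partial matchings. The second-moment comparison only needs E (H G), which is computable
    because exp S is a product over the entries.

    In the limit theorem for S the test function is only bounded and continuous, so it cannot be
    Taylor expanded. The added noise moves all derivatives onto the heat kernel, whose third
    derivative is bounded uniformly over all variances at least a. Each of the n^2 replacements
    matches two moments and costs O(n^-3), hence O(1/n) in total for a fixed noise variance a. *)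

Definition expect {R : realType} (p : R) (n : nat) (X : bmatrix n -> R) : R :=
  \sum_(xi : bmatrix n) bern_weight p xi * X xi.

(* The entry [xi / p - 1] of the centred and normalized matrix. *)
Definition ceta {R : realType} (p : R) (b : bool) : R :=
  if b then (1 - p) / p else -1.

Definition Sn {R : realType} (p : R) (n : nat) (xi : bmatrix n) : R :=
  \sum_k ceta p (xi k) / n%:R.

Definition mgf {R : realType} (p l : R) : R :=
  p * expR (l * ceta p true) + (1 - p) * expR (l * ceta p false).

Lemma prod_perm_graph {R : comRingType} (n : nat) (s : 'S_n)
    (F : 'I_n * 'I_n -> R) :
  \prod_(i < n) F (i, s i) = \prod_k (if k.2 == s k.1 then F k else 1).
Proof.
transitivity (\prod_i \prod_j (if j == s i then F (i, j) else 1)).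
  by apply: eq_bigr => i _; rewrite -big_mkcond/= big_pred1_eq.
by rewrite pair_bigA/=; apply: eq_bigr => -[].
Qed.

Lemma sum_card_set {R : comRingType} (T : finType) (F : nat -> R) :
  \sum_(A : {set T}) F #|A| = \sum_(k < #|T|.+1) 'C(#|T|, k)%:R * F k.
Proof.
rewrite (partition_big (fun A : {set T} => inord #|A| : 'I_#|T|.+1) xpredT)//=.
apply: eq_bigr => k _.
have cA (A : {set T}) : (inord #|A| == k) = (#|A| == k).
  by rewrite -val_eqE/= inordK// ltnS max_card.
rewrite (eq_bigr (fun=> F k)) => [|A]; last by rewrite cA => /eqP ->.
rewrite (eq_bigl _ _ cA) sumr_const mulr_natl -card_draws; congr (_ *+ _).
by apply: eq_card => A; rewrite !inE.
Qed.

Section expectation.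
Context {R : realType} (p : R) (n : nat).
Implicit Types X Y : bmatrix n -> R.
Local Notation E := (@expect R p n).

Lemma expect_ext X Y : X =1 Y -> E X = E Y.
Proof. by move=> XY; apply: eq_bigr => xi _; rewrite XY. Qed.

Lemma expectD X Y : E (fun xi => X xi + Y xi) = E X + E Y.
Proof. by rewrite -big_split/=; apply: eq_bigr => xi _; rewrite mulrDr. Qed.

Lemma expectZ a X : E (fun xi => a * X xi) = a * E X.
Proof. by rewrite /expect big_distrr/=; apply: eq_bigr => xi _; ring. Qed.

Lemma expectB X Y : E (fun xi => X xi - Y xi) = E X - E Y.
Proof. by rewrite -sumrB; apply: eq_bigr => xi _; rewrite mulrBr. Qed.

Lemma expect_sum (I : finType) (X : I -> bmatrix n -> R) :
  E (fun xi => \sum_i X i xi) = \sum_i E (X i).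
Proof.
rewrite /expect exchange_big/=; apply: eq_bigr => xi _.
by rewrite big_distrr.
Qed.

(** Independence of the entries: expanding a product of two-term sums enumerates exactly the boolean
    matrices. *)
Lemma expect_prod (F : 'I_n * 'I_n -> bool -> R) :
  E (fun xi => \prod_k F k (xi k)) =
  \prod_k (p * F k true + (1 - p) * F k false).
Proof.
under [RHS]eq_bigr => k _ do
  rewrite -(big_bool _ (fun b : bool => (if b then p else 1 - p) * F k b))/=.
rewrite bigA_distr_bigA/=; apply: eq_bigr => xi _.
by rewrite -big_split.
Qed.

Lemma expect_cst c : E (fun=> c) = c.
Proof.
transitivity (c * E (fun xi => \prod_k (fun _ _ => 1) k (xi k))).
  by rewrite -expectZ; apply: expect_ext => xi; rewrite big1 ?mulr1.
by rewrite (expect_prod (fun _ _ => 1)) big1 ?mulr1// => k _; ring.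
Qed.

Hypotheses (hp0 : 0 < p) (hp1 : p < 1).

Lemma bern_weight_ge0 (xi : bmatrix n) : 0 <= bern_weight p xi.
Proof. by apply: prodr_ge0 => k _; case: ifP => _; rewrite ?subr_ge0 ltW. Qed.

Lemma le_expect X Y : (forall xi, X xi <= Y xi) -> E X <= E Y.
Proof.
by move=> XY; apply: ler_sum => xi _; rewrite ler_wpM2l ?bern_weight_ge0 ?XY.
Qed.

Lemma normr_expect X : `|E X| <= E (fun xi => `|X xi|).
Proof.
apply: le_trans (ler_norm_sum _ _ _) _; apply: ler_sum => xi _.
by rewrite normrM (ger0_norm (bern_weight_ge0 xi)).
Qed.

Lemma expect_expR_Sn l :
  E (fun xi => expR (l * Sn p n xi)) = mgf p (l / n%:R) ^+ (n * n)%N.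
Proof.
transitivity (E (fun xi => \prod_k expR (l / n%:R * ceta p (xi k)))).
  apply: expect_ext => xi; rewrite -expR_sum big_distrr/=; congr expR.
  by apply: eq_bigr => k _; ring.
rewrite (expect_prod (fun _ b => expR (l / n%:R * ceta p b))) prodr_const.
by rewrite card_prod card_ord.
Qed.

(** Spreading the power of [p] over the n factors gives each factor mean 1. *)
Lemma HnE (xi : bmatrix n) :
  Hn p xi = (n`!%:R)^-1 * \sum_(s : 'S_n) \prod_(i < n) ((xi (i, s i))%:R / p).
Proof.
rewrite /Hn invfM -mulrA [X in _ = _ * X](_ : _ =
  (p ^+ n)^-1 * \sum_(s : 'S_n) \prod_(i < n) (xi (i, s i))%:R); last first.
  rewrite big_distrr/=; apply: eq_bigr => s _.
  rewrite big_split/= prodr_const card_ord exprVn mulrC.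
  by [].
by ring.
Qed.

Lemma fact_neq0 : n`!%:R != 0 :> R.
Proof. by rewrite pnatr_eq0 -lt0n fact_gt0. Qed.

Lemma sumr_perm_const (c : R) : \sum_(s : 'S_n) c = n`!%:R * c.
Proof. by rewrite sumr_const card_Sn -[LHS]mulr_natl. Qed.

(** All permutations contribute equally. On the graph of [s] only the value [true] survives and [p]
    cancels, leaving exp (q / n) for each of n entries; each of the other n^2 - n entries
    contributes [mgf p n%:R^-1]. *)
Lemma expect_Hn_expR_Sn : (0 < n)%N ->
  E (fun xi => Hn p xi * expR (Sn p n xi)) =
  expR ((1 - p) / p) * mgf p (n%:R^-1) ^+ (n * n - n)%N.
Proof.
move=> n0; have n0R : n%:R != 0 :> R by rewrite pnatr_eq0 -lt0n.
have p0 : p != 0 by rewrite gt_eqF.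
pose F (s : 'S_n) (k : 'I_n * 'I_n) (b : bool) : R :=
  (if k.2 == s k.1 then b%:R / p else 1) * expR (ceta p b / n%:R).
transitivity (n`!%:R^-1 * \sum_(s : 'S_n) E (fun xi => \prod_k F s k (xi k))).
  rewrite -expect_sum -expectZ; apply: expect_ext => xi.
  rewrite HnE -mulrA big_distrl/=; congr (_ * _); apply: eq_bigr => s _.
  rewrite (prod_perm_graph _ s (fun k => (xi k)%:R / p)).
  by rewrite expR_sum -big_split.
rewrite (eq_bigr (fun=> expR ((1 - p) / p) * mgf p n%:R^-1 ^+ (n * n - n)%N)).
  by rewrite sumr_perm_const mulKf ?fact_neq0.
move=> s _; rewrite expect_prod.
rewrite (bigID (fun k : 'I_n * 'I_n => k.2 == s k.1))/=.
have cn : #|[pred k : 'I_n * 'I_n | k.2 == s k.1]| = n.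
  have inj : injective (fun i : 'I_n => (i, s i)) by move=> i j [].
  rewrite -[RHS]card_ord -cardsT -(card_imset [set: 'I_n] inj).
  apply: eq_card => k; rewrite !inE; apply/eqP/imsetP => [ks|[i _ ->]//].
  by exists k.1; rewrite // -ks; case: k {ks}.
rewrite (eq_bigr (fun=> expR (n%:R^-1 * ((1 - p) / p)))); last first.
  move=> k ks; rewrite /F ks /ceta/=.
  by rewrite mul0r mul0r mulr0 addr0 mulrA mulrC div1r mulrV ?unitfE// mulr1 mulrC.
rewrite [X in _ * X](eq_bigr (fun=> mgf p n%:R^-1)); last first.
  by move=> k /negbTE ks; rewrite /F ks /mgf !mul1r ![_^-1 * _]mulrC.
rewrite !prodr_const cn -expRM_natl mulVKf//; congr (_ * _ ^+ _).
have := cardC [pred k : 'I_n * 'I_n | k.2 == s k.1].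
rewrite cn card_prod card_ord => <-.
by rewrite addKn; apply: eq_card => k; rewrite !inE.
Qed.

(** Expanding the product sums q^#|A| over the sets A of fixed points of [s]. Exactly (n - #|A|)!
    permutations fix A pointwise, and C(n, k) (n - k)! = n! / k!. *)
Lemma sum_perm_fix (q : R) :
  \sum_(s : 'S_n) \prod_(i < n) (if s i == i then 1 + q else 1) =
  n`!%:R * \sum_(k < n.+1) q ^+ k / k`!%:R.
Proof.
transitivity (\sum_(s : 'S_n) \sum_(A : {set 'I_n})
    (if s \in perm_on (~: A) then q ^+ #|A| else 0)).
  apply: eq_bigr => s _.
  rewrite (eq_bigr (fun i => \sum_(b : bool)
      if b then (if s i == i then q else 0) else 1)); last first.
    by move=> i _; rewrite big_bool/=; case: ifP => _; ring.
  rewrite bigA_distr_bigA/=.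
  rewrite (reindex (fun A : {set 'I_n} => [ffun i => i \in A]))/=; last first.
    exists (fun f => [set i | f i]) => [A _|f _].
      by apply/setP => i; rewrite inE ffunE.
    by apply/ffunP => i; rewrite ffunE inE.
  apply: eq_bigr => A _; rewrite -big_mkcond/=; case: ifPn => sA.
    rewrite (eq_bigr (fun=> q)) => [|i].
      rewrite prodr_const; congr (_ ^+ _).
      apply: eq_card => i; exact: ffunE.
    by rewrite ffunE => iA; rewrite (out_perm sA) ?eqxx// inE negbK.
  have /existsP[i /andP[iA sii]] : [exists i, (i \in A) && (s i != i)].
    apply: contraNT sA => /existsPn h; apply/fintype.subsetP => i.
    by rewrite !inE => si; apply/negP => iA; have := h i; rewrite iA si.
  by rewrite (bigD1 i)/= ?ffunE// (negbTE sii) mul0r.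
rewrite exchange_big/=.
transitivity (\sum_(A : {set 'I_n}) q ^+ #|A| * (n - #|A|)`!%:R).
  apply: eq_bigr => A _; rewrite -big_mkcond/= sumr_const card_perm.
  by rewrite cardsCs finset.setCK card_ord mulr_natr.
rewrite (@sum_card_set _ _ (fun k => q ^+ k * (n - k)`!%:R)) card_ord.
rewrite big_distrr/=; apply: eq_bigr => k _.
rewrite -(bin_fact (ltn_ord k : (k <= n)%N)) !natrM.
have k0 : k`!%:R != 0 :> R by rewrite pnatr_eq0 -lt0n fact_gt0.
by field.
Qed.

(** For a pair [s], [t], an entry on both graphs contributes E (xi / p)^2 = 1 / p = 1 + q and any
    other entry contributes 1. The common entries correspond to the fixed points of
    [(t * s^-1)%g]. *)
Lemma expect_Hn2 :
  E (fun xi => Hn p xi ^+ 2) = \sum_(k < n.+1) ((1 - p) / p) ^+ k / k`!%:R.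
Proof.
have p0 : p != 0 by rewrite gt_eqF.
pose G (s : 'S_n) (k : 'I_n * 'I_n) (b : bool) : R :=
  if k.2 == s k.1 then b%:R / p else 1.
have HE xi : Hn p xi = n`!%:R^-1 * \sum_(s : 'S_n) \prod_k G s k (xi k).
  rewrite HnE; congr (_ * _); apply: eq_bigr => s _.
  by rewrite (prod_perm_graph _ s (fun k => (xi k)%:R / p)).
transitivity (n`!%:R^-1 ^+ 2 * \sum_(s : 'S_n) \sum_(t : 'S_n)
    E (fun xi => \prod_k (G s k (xi k) * G t k (xi k)))).
  under eq_bigr => s _ do rewrite -expect_sum.
  rewrite -expect_sum -expectZ; apply: expect_ext => xi.
  rewrite HE exprMn; congr (_ * _); rewrite expr2 big_distrl/=.
  apply: eq_bigr => s _; rewrite big_distrr/=; apply: eq_bigr => t _.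
  by rewrite big_split.
have inner (s t : 'S_n) : E (fun xi => \prod_k (G s k (xi k) * G t k (xi k))) =
    \prod_(i < n) (if (t * s^-1)%g i == i then 1 + (1 - p) / p else 1).
  rewrite (expect_prod (fun k b => G s k b * G t k b)).
  rewrite -(pair_bigA _ (fun i j => p * (G s (i, j) true * G t (i, j) true) +
    (1 - p) * (G s (i, j) false * G t (i, j) false)))/=.
  apply: eq_bigr => i _; rewrite permM /G/= (can2_eq (permKV s) (permK s)).
  case: eqP => [tsi|/eqP tsi].
    rewrite tsi (bigD1 (s i))//= eqxx big1 => [|j /negbTE ->]; last by ring.
    by field.
  rewrite (bigD1 (s i))//= (bigD1 (t i))//= eqxx eq_sym (negbTE tsi) eqxx.
  rewrite big1 => [|j /andP[/negbTE -> /negbTE ->]]; last by ring.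
  by field.
under eq_bigr => s _ do under eq_bigr => t _ do rewrite inner.
(* Right translation by [s] removes [s] from the inner sum, which is then the same for every [s]. *)
under eq_bigr => s _ do rewrite (reindex_inj (mulIg s))/=.
under eq_bigr => s _ do under eq_bigr => t _ do rewrite mulgK.
under eq_bigr => s _ do rewrite sum_perm_fix.
rewrite sumr_perm_const expr2.
by have := fact_neq0 => f0; field.
Qed.

End expectation.

Local Open Scope classical_set_scope.
Local Open Scope ring_scope.

(** * Calculus *)

Section calculus.
Context {R : realType}.

Lemma invn_cvg0 : (n%:R^-1 : R) @[n --> \oo] --> 0.
Proof.
rewrite -(cvg_shiftS (fun n => n%:R^-1 : R)).
exact: cvg_harmonic.
Qed.

(** This rule and the next three are stated on explicit lambdas, so that applying them after
    [eapply is_derive_eq] synthesizes the derivative, which [ring] or [field] then compares with the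
    expected one. *)
Lemma is_derive_mul (f g : R -> R) (x a b : R) :
  is_derive x 1 f a -> is_derive x 1 g b ->
  is_derive x 1 (fun z => f z * g z) (a * g x + f x * b).
Proof.
move=> fa gb; apply: (is_derive_eq (is_deriveM fa gb)).
by rewrite addrC -![_ *: _]/(_ * _) [g x * a]mulrC.
Qed.

Lemma is_derive_add (f g : R -> R) (x a b : R) :
  is_derive x 1 f a -> is_derive x 1 g b ->
  is_derive x 1 (fun z => f z + g z) (a + b).
Proof. exact: is_deriveD. Qed.

Lemma is_derive_opp (f : R -> R) (x a : R) :
  is_derive x 1 f a -> is_derive x 1 (fun z => - f z) (- a).
Proof. exact: is_deriveN. Qed.

Lemma is_derive_sqr (f : R -> R) (x a : R) :
  is_derive x 1 f a -> is_derive x 1 (fun z => f z ^+ 2) (2 * f x * a).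
Proof.
by move=> fa; apply: (is_derive_eq (is_derive_mul _ _ _ _ _ fa fa)); ring.
Qed.

(** Locating [c] only by its distance to [x] makes the statement independent of the order of [x] and
    [y], so Taylor bounds can be chained without case distinctions. *)
Lemma mean_value (f df : R -> R) (x y : R) :
  (forall z : R, is_derive z 1 f (df z)) ->
  exists2 c, `|c - x| <= `|y - x| & f y - f x = df c * (y - x).
Proof.
move=> fdf.
have cf : continuous f.
  by move=> z; apply/differentiable_continuous/derivable1_diffP; case: (fdf z).
have [xy|yx] := leP x y.
  have [c] := MVT_segment xy (fun z _ => fdf z) (continuous_subspaceT cf).
  rewrite in_itv/= => /andP[xc cy] E; exists c => //.
  by rewrite !ger0_norm ?subr_ge0// lerB.
have [c] := MVT_segment (ltW yx) (fun z _ => fdf z) (continuous_subspaceT cf).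
rewrite in_itv/= => /andP[yc cx] E; exists c.
  by rewrite !ler0_norm ?subr_le0 ?(ltW yx)// !opprB lerB.
by rewrite -[LHS]opprB E; ring.
Qed.

(** For c >= 0, the bound 1 - c <= exp (- c) gives exp c <= 1 / (1 - c), and 1 - c >= 1/2. *)
Lemma expR_sub1_le (c : R) : `|c| <= 2^-1 -> `|expR c - 1| <= 2 * `|c|.
Proof.
move=> hc; have h1 := expR_ge1Dx c.
have [c0|c0] := leP 0 c; last first.
  have : expR c <= 1 by rewrite expR_le1 ltW.
  by move=> ?; rewrite !ler0_norm; lra.
rewrite !ger0_norm//; last by lra.
rewrite ger0_norm// in hc.
have := expR_ge1Dx (- c); rewrite expRN => h2.
have : expR c * (1 - c) <= 1.
  apply: le_trans (ler_wpM2l (expR_ge0 c) h2) _.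
  by rewrite mulfV// gt_eqF// expR_gt0.
by move=> h3; nra.
Qed.

(** The derivative of a Taylor remainder is the previous remainder, so the mean value theorem from 0
    gains one power of |x| and keeps the constant 2; likewise for the next order. *)
Lemma expR_taylor1 (x : R) : `|x| <= 2^-1 -> `|expR x - 1 - x| <= 2 * `|x| ^+ 2.
Proof.
move=> hx.
have df z : is_derive z (1 : R) (fun z => expR z - z) (expR z - 1).
  exact: is_deriveB.
have [c] := @mean_value _ _ 0 x df.
rewrite !subr0 expR0 => cx E.
have -> : expR x - 1 - x = (expR c - 1) * x by rewrite -E; ring.
rewrite normrM expr2 mulrA ler_wpM2r//.
apply: le_trans (expR_sub1_le _ _) _; first exact: le_trans hx.
by rewrite ler_wpM2l.
Qed.

Lemma expR_taylor2 (x : R) : `|x| <= 2^-1 ->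
  `|expR x - 1 - x - x ^+ 2 / 2| <= 2 * `|x| ^+ 3.
Proof.
move=> hx.
have df z : is_derive z (1 : R) (fun z => expR z - z - z ^+ 2 / 2) (expR z - 1 - z).
  eapply is_derive_eq.
    apply is_derive_add; first exact: is_deriveB.
    apply is_derive_opp, is_derive_mul; last exact: is_derive_cst.
    by apply is_derive_sqr, is_derive_id.
  by rewrite /=; field.
have [c] := @mean_value _ _ 0 x df.
rewrite !subr0 expR0 expr0n/= mul0r subr0 => cx E.
have -> : expR x - 1 - x - x ^+ 2 / 2 = (expR c - 1 - c) * x by rewrite -E; ring.
rewrite normrM exprSr mulrA ler_wpM2r//.
apply: le_trans (expR_taylor1 _ _) _; first exact: le_trans hx.
by rewrite ler_wpM2l// ler_sqr ?nnegrE.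
Qed.

(** Squeeze between exp (x / (1 + x)) <= 1 + x <= exp x. The lower bound is the upper one at - x /
    (1 + x), inverted. *)
Lemma expn_cvg_expR (x : nat -> R) (k : nat -> nat) (c : R) :
  x @ \oo --> 0 -> (k n)%:R * x n @[n --> \oo] --> c ->
  (1 + x n) ^+ k n @[n --> \oo] --> expR c.
Proof.
move=> x0 kx.
apply: (@squeeze_cvgr _ _ _ _ (fun n => expR ((k n)%:R * x n * (1 + x n)^-1))
  (fun n => expR ((k n)%:R * x n))).
- near=> n.
  have xn : `|x n| < 2^-1.
    by near: n; apply: cvgr0_norm_lt => //; rewrite invr_gt0.
  have x1 : 0 < 1 + x n by move: xn; rewrite ltr_norml => /andP[? ?]; lra.
  apply/andP; split; last first.
    by rewrite expRM_natl lerXn2r ?nnegrE ?expR_ge0 ?expR_ge1Dx ?ltW.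
  rewrite -mulrA expRM_natl lerXn2r ?nnegrE ?expR_ge0 ?(ltW x1)//.
  have := expR_ge1Dx (- (x n / (1 + x n))).
  rewrite expRN [X in X <= _](_ : _ = (1 + x n)^-1); last first.
    by field; rewrite gt_eqF.
  by rewrite lef_pV2 ?posrE ?expR_gt0.
- apply: continuous_cvg; first exact: continuous_expR.
  rewrite -[X in _ --> X]mulr1; apply: cvgM => //.
  rewrite -[X in _ --> X]invr1; apply: cvgV; first exact: oner_neq0.
  by rewrite -[X in _ --> X]addr0; apply: cvgD => //; exact: cvg_cst.
- by apply: continuous_cvg => //; exact: continuous_expR.
Unshelve. all: by end_near. Qed.

Lemma expR_sum_cvg (q : R) :
  \sum_(k < n.+1) q ^+ k / k`!%:R @[n --> \oo] --> expR q.
Proof.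
have h : series (exp_coeff q) @ \oo --> expR q by exact: is_cvg_series_exp_coeff.
rewrite -cvg_shiftS in h; apply: cvg_trans h; apply: near_eq_cvg.
by apply: nearW => n; rewrite /series/= big_mkord.
Qed.

(* A bounded continuous function is uniformly continuous up to an error that
   is controlled by second moments. *)
Lemma bounded_continuous_modulus (f : R -> R) (M : R) :
  continuous f -> (forall x, `|f x| <= M) -> forall e : R, 0 < e ->
  exists2 C, 0 <= C & forall x y,
    `|f x - f y| <= e * (1 + x ^+ 2) + C * (x - y) ^+ 2.
Proof.
move=> cf fM e e0.
have M0 : 0 <= M by apply: le_trans (fM 0).
have fxy x y : `|f x - f y| <= 2 * M.
  by apply: le_trans (ler_normB _ _) _; have := fM x; have := fM y; lra.
(* Beyond [K] the weight alone suffices: e x^2 >= e K >= 2 M, where K >= 1 is used for x^2 >= K. *)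
pose K := 1 + 2 * M / e.
have K1 : 1 <= K by rewrite lerDl divr_ge0// ?mulr_ge0// ltW.
have eK : 2 * M <= e * K.
  have -> : e * K = e + 2 * M by rewrite /K; field; rewrite gt_eqF.
  by rewrite lerDr ltW.
have /compact_near_coveringP cK : compact `[- K, K] by exact: segment_compact.
(* Compactness along the filter of small positive [d] yields one radius valid for all x in
   [-K, K]. *)
have [] := cK _ 0^'+ (fun d x => forall y, `|x - y| < d -> `|f x - f y| <= e).
- move=> x _.
  have /cvgrPdist_lt/(_ (e / 2)) := cf x.
  rewrite divr_gt0// => /(_ isT) [d /= d0 fd].
  near=> x' d' => /= y x'y.
  have x'x : `|x - x'| < d / 2.
    by near: x'; exists (d / 2) => //=; rewrite divr_gt0.
  have d'd : d' < d / 2.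
    by near: d'; apply: nbhs_right_lt; rewrite divr_gt0.
  have h1 : `|f x - f x'| < e / 2 by apply: fd; apply: lt_trans x'x _; lra.
  have h2 : `|f x - f y| < e / 2.
    apply: fd => /=; rewrite (_ : x - y = (x - x') + (x' - y)); last by ring.
    by apply: le_lt_trans (ler_normD _ _) _; lra.
  rewrite (_ : f x' - f y = (f x - f y) - (f x - f x')); last by ring.
  by apply: le_trans (ler_normB _ _) _; lra.
move=> d /= d0 /(_ (d / 2)) h.
have {}h : forall x, `|x| <= K -> forall y, `|x - y| < d / 2 -> `|f x - f y| <= e.
  move=> x xK; apply: h.
  - by rewrite /= sub0r normrN gtr0_norm; lra.
  - by rewrite divr_gt0.
  - by rewrite /= in_itv/= -ler_norml.
have d2 : 0 < (d / 2) ^+ 2 by rewrite exprn_gt0// divr_gt0.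
exists (2 * M / (d / 2) ^+ 2) => [|x y].
  by rewrite divr_ge0 ?mulr_ge0// ltW.
have C0 : 0 <= 2 * M / (d / 2) ^+ 2 * (x - y) ^+ 2.
  by rewrite mulr_ge0 ?sqr_ge0// divr_ge0 ?mulr_ge0// ltW.
have ex : 0 <= e * x ^+ 2 by rewrite mulr_ge0 ?sqr_ge0// ltW.
have [xK|xK] := leP `|x| K; last first.
  have Kx : K <= x ^+ 2.
    rewrite -real_normK ?num_real//; nra.
  have := fxy x y; have : e * K <= e * x ^+ 2 by rewrite ler_pM2l.
  lra.
have [xy|xy] := ltP `|x - y| (d / 2); first by have := h x xK y xy; lra.
have : 2 * M <= 2 * M / (d / 2) ^+ 2 * (x - y) ^+ 2.
  rewrite -mulrA ler_peMr ?mulr_ge0// mulrC ler_pdivlMr// mul1r.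
  by rewrite -[leRHS]real_normK ?num_real// ler_sqr ?nnegrE// divr_ge0// ltW.
by have := fxy x y; lra.
Unshelve. all: by end_near. Qed.

End calculus.

(** * Second-moment comparison *)

Lemma cvg_invn_rate {R : realType} (u : nat -> R) (c K : R) :
  (\forall n \near \oo, `|u n - c| <= K / n%:R) -> u @ \oo --> c.
Proof.
move=> h.
have K0 : K / n%:R @[n --> \oo] --> 0.
  by rewrite -(mulr0 K); apply: cvgM; [exact: cvg_cst|exact: invn_cvg0].
apply: (@squeeze_cvgr _ _ _ _ (fun n => c - K / n%:R) (fun n => c + K / n%:R)).
- near=> n; have : `|u n - c| <= K / n%:R by near: n.
  by rewrite ler_norml => /andP[? ?]; apply/andP; split; lra.
- by rewrite -[X in _ --> X]subr0; apply: cvgB => //; exact: cvg_cst.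
- by rewrite -[X in _ --> X]addr0; apply: cvgD => //; exact: cvg_cst.
Unshelve. all: by end_near. Qed.

Lemma near_eq_cvgn {R : realType} (u v : nat -> R) (l : R) :
  (\forall n \near \oo, u n = v n) -> u @ \oo --> l -> v @ \oo --> l.
Proof. by move=> uv; apply: cvg_trans; exact: near_eq_cvg. Qed.

Section moments.
Context {R : realType} (p : R).
Hypotheses (hp0 : 0 < p) (hp1 : p < 1).
Local Notation q := ((1 - p) / p).

Let p_neq0 : p != 0. Proof. by rewrite gt_eqF. Qed.

Let q_gt0 : 0 < q. Proof. by rewrite divr_gt0// subr_gt0. Qed.

Lemma mgf_gt0 (l : R) : 0 < mgf p l.
Proof. by rewrite /mgf addr_gt0// mulr_gt0 ?expR_gt0// subr_gt0. Qed.

(** [ceta] has mean 0 and variance p q^2 + (1 - p) = q, which leaves q l^2 / 2; its two values are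
    bounded by 1 + q in absolute value. *)
Lemma mgf_taylor (l : R) : `|l| * (1 + q) <= 2^-1 ->
  `|mgf p l - 1 - q / 2 * l ^+ 2| <= 2 * (1 + q) ^+ 3 * `|l| ^+ 3.
Proof.
move=> hl; have q0 := q_gt0.
have hlq (b : bool) : `|l * ceta p b| <= `|l| * (1 + q).
  rewrite normrM ler_wpM2l//; case: b => /=.
    by rewrite gtr0_norm// lerDr.
  by rewrite normrN normr1 lerDl ltW.
have h b := expR_taylor2 (l * ceta p b) (le_trans (hlq b) hl).
have h3 (b : bool) : `|l * ceta p b| ^+ 3 <= (1 + q) ^+ 3 * `|l| ^+ 3.
  by rewrite [leRHS]mulrC -exprMn lerXn2r ?nnegrE ?hlq ?mulr_ge0 ?addr_ge0 ?(ltW q0).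
rewrite (_ : mgf p l - 1 - q / 2 * l ^+ 2 =
  p * (expR (l * ceta p true) - 1 - l * ceta p true - (l * ceta p true) ^+ 2 / 2) +
  (1 - p) * (expR (l * ceta p false) - 1 - l * ceta p false -
     (l * ceta p false) ^+ 2 / 2)); last by rewrite /mgf /ceta; field.
apply: le_trans (ler_normD _ _) _.
rewrite !normrM (gtr0_norm hp0) (@gtr0_norm _ (1 - p)) ?subr_gt0//.
have ht := le_trans (h true) (ler_wpM2l (ler0n _ 2) (h3 true)).
have hf := le_trans (h false) (ler_wpM2l (ler0n _ 2) (h3 false)).
have ht' := ler_wpM2l (ltW hp0) ht.
have p1 : 0 <= 1 - p by rewrite subr_ge0 ltW.
have hf' := ler_wpM2l p1 hf.
apply: le_trans (lerD ht' hf') _.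
by rewrite -mulrDl addrC subrK mul1r mulrA.
Qed.

Lemma mgf_taylorn (l : R) : \forall n \near \oo, (0 < n)%N /\
  `|n%:R ^+ 2 * (mgf p (l / n%:R) - 1) - q / 2 * l ^+ 2| <=
  2 * (1 + q) ^+ 3 * `|l| ^+ 3 / n%:R.
Proof.
near=> n.
have n0 : (0 < n)%N by near: n; exact: nbhs_infty_gt.
split => //; have n0R : 0 < n%:R :> R by rewrite ltr0n.
have hl : `|l / n%:R| * (1 + q) <= 2^-1.
  rewrite normrM (@gtr0_norm _ n%:R^-1) ?invr_gt0// mulrAC ler_pdivrMr//.
  rewrite -ler_pdivrMl ?invr_gt0//.
  by near: n; exact: nbhs_infty_ger.
have := mgf_taylor _ hl => h.
rewrite (_ : _ - _ = n%:R ^+ 2 *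
  (mgf p (l / n%:R) - 1 - q / 2 * (l / n%:R) ^+ 2)); last first.
  by field; rewrite p_neq0 gt_eqF.
rewrite normrM (@ger0_norm _ (n%:R ^+ 2)) ?sqr_ge0//.
apply: le_trans (ler_wpM2l (sqr_ge0 _) h) _.
rewrite normrM (@gtr0_norm _ n%:R^-1) ?invr_gt0//.
rewrite le_eqVlt; apply/orP; left; apply/eqP; field.
by rewrite p_neq0 gt_eqF.
Unshelve. all: by end_near. Qed.

Lemma mgf_sqn_cvg (l : R) :
  n%:R ^+ 2 * (mgf p (l / n%:R) - 1) @[n --> \oo] --> q / 2 * l ^+ 2.
Proof.
by apply: cvg_invn_rate; apply: filterS (mgf_taylorn l) => n [_]; exact.
Qed.

Lemma mgf_invn_cvg0 (l : R) :
  n%:R * (mgf p (l / n%:R) - 1) @[n --> \oo] --> 0.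
Proof.
rewrite -(mul0r (q / 2 * l ^+ 2)).
have h := cvgM (@invn_cvg0 R) (mgf_sqn_cvg l).
apply: near_eq_cvgn (h _); near=> n.
have n0 : (0 < n)%N by near: n; exact: nbhs_infty_gt.
by rewrite /= expr2 -mulrA mulKf// pnatr_eq0 -lt0n.
Unshelve. all: by end_near. Qed.

Lemma mgf_sub1_cvg0 (l : R) : mgf p (l / n%:R) - 1 @[n --> \oo] --> 0.
Proof.
rewrite -(mul0r (0 : R)).
have h := cvgM (@invn_cvg0 R) (mgf_invn_cvg0 l).
apply: near_eq_cvgn (h _); near=> n.
have n0 : (0 < n)%N by near: n; exact: nbhs_infty_gt.
by rewrite /= mulKf// pnatr_eq0 -lt0n.
Unshelve. all: by end_near. Qed.

Lemma mgf_expn2_cvg (l : R) :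
  mgf p (l / n%:R) ^+ (n * n)%N @[n --> \oo] --> expR (q / 2 * l ^+ 2).
Proof.
apply: (@near_eq_cvgn _ (fun n => (1 + (mgf p (l / n%:R) - 1)) ^+ (n * n)%N)).
  by apply: nearW => n; rewrite addrC subrK.
apply: expn_cvg_expR; first exact: mgf_sub1_cvg0.
by under eq_fun do rewrite natrM -expr2; exact: mgf_sqn_cvg.
Qed.

Lemma mgf_expn_cvg (l : R) : mgf p (l / n%:R) ^+ n @[n --> \oo] --> (1 : R).
Proof.
rewrite -[X in _ --> X]expR0.
apply: (@near_eq_cvgn _ (fun n => (1 + (mgf p (l / n%:R) - 1)) ^+ n)).
  by apply: nearW => n; rewrite addrC subrK.
by apply: (expn_cvg_expR (fun n => mgf p (l / n%:R) - 1) id); [exact: mgf_sub1_cvg0|exact: mgf_invn_cvg0].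
Qed.

Lemma expect_expR_Sn_cvg (l : R) :
  expect p n (fun xi => expR (l * Sn p n xi)) @[n --> \oo] -->
  expR (q / 2 * l ^+ 2).
Proof.
by under eq_fun do rewrite expect_expR_Sn; exact: mgf_expn2_cvg.
Qed.

Definition Gn (n : nat) (xi : bmatrix n) : R := expR (Sn p n xi - q / 2).

(** The power n^2 - n of the [mgf] is split as a quotient: the n^2-th power tends to exp (q / 2) and
    the n-th power to 1, whence the [/ 1] in the rewritten limit. *)
Lemma expect_HnGn_cvg :
  expect p n (fun xi => Hn p xi * Gn n xi) @[n --> \oo] --> expR q.
Proof.
have -> : expR q = expR (- (q / 2)) * (expR q * (expR (q / 2 * 1 ^+ 2) / 1)).
  by rewrite divr1 -!expRD; congr expR; ring.
apply: (@near_eq_cvgn _ (fun n => expR (- (q / 2)) * (expR q *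
    (mgf p (1 / n%:R) ^+ (n * n)%N * (mgf p (1 / n%:R) ^+ n)^-1)))); last first.
  apply: cvgM; first exact: cvg_cst.
  apply: cvgM; first exact: cvg_cst.
  apply: cvgM; first exact: mgf_expn2_cvg.
  by apply: cvgV; [exact: oner_neq0|exact: mgf_expn_cvg].
near=> n.
have n0 : (0 < n)%N by near: n; exact: nbhs_infty_gt.
transitivity (expR (- (q / 2)) *
    expect p n (fun xi => Hn p xi * expR (Sn p n xi))); last first.
  by rewrite -expectZ; apply: expect_ext => xi; rewrite /Gn expRD; ring.
rewrite expect_Hn_expR_Sn//= div1r; congr (_ * (_ * _)).
rewrite /= -exprB ?unitfE ?gt_eqF ?mgf_gt0//.
by rewrite leq_pmull.
Unshelve. all: by end_near. Qed.

Lemma expect_Gn2_cvg :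
  expect p n (fun xi => Gn n xi ^+ 2) @[n --> \oo] --> expR q.
Proof.
have -> : expR q = expR (- q) * expR (q / 2 * 2 ^+ 2).
  by rewrite -!expRD; congr expR; field.
apply: (@near_eq_cvgn _ (fun n => expR (- q) *
    expect p n (fun xi => expR (2 * Sn p n xi)))); last first.
  by apply: cvgM; [exact: cvg_cst|exact: expect_expR_Sn_cvg].
apply: nearW => n; rewrite -expectZ; apply: expect_ext => xi.
by rewrite /Gn expr2 -!expRD; congr expR; field.
Qed.

Lemma expect_HnBGn2_cvg :
  expect p n (fun xi => (Hn p xi - Gn n xi) ^+ 2) @[n --> \oo] --> 0.
Proof.
have -> : 0 = expR q - 2 * expR q + expR q by ring.
apply: (@near_eq_cvgn _ (fun n => \sum_(k < n.+1) q ^+ k / k`!%:R -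
    2 * expect p n (fun xi => Hn p xi * Gn n xi) +
    expect p n (fun xi => Gn n xi ^+ 2))); last first.
  apply: cvgD; last exact: expect_Gn2_cvg.
  apply: cvgB; first exact: expR_sum_cvg.
  by apply: cvgM; [exact: cvg_cst|exact: expect_HnGn_cvg].
apply: nearW => n; rewrite -expect_Hn2// -expectZ -expectB -expectD; apply: expect_ext => xi.
by ring.
Qed.

Lemma expect_Hn2_le (n : nat) : expect p n (fun xi => Hn p xi ^+ 2) <= expR q.
Proof.
rewrite expect_Hn2//.
rewrite /expR -(big_mkord xpredT (fun k => q ^+ k / k`!%:R)).
apply: nondecreasing_cvgn_le; last exact: is_cvg_series_exp_coeff.
apply: nondecreasing_series => k _ _; rewrite /exp_coeff/=.
by rewrite divr_ge0// exprn_ge0// ltW// q_gt0.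
Qed.

Lemma expect_f_HnBGn_cvg (f : R -> R) (M : R) : continuous f ->
  (forall x, `|f x| <= M) ->
  expect_f_Hn p n f - expect p n (fun xi => f (Gn n xi)) @[n --> \oo] --> 0.
Proof.
move=> cf fM; apply/cvgr0Pnorm_le => e e0.
(* The quadratic weight of the modulus falls on [Hn], whose second moment is at most [expR q] for
   every n; this choice makes that term at most e / 2. *)
pose e' := e / (2 * (1 + expR q)).
have E0 : 0 < 1 + expR q by rewrite addr_gt0// expR_gt0.
have e'0 : 0 < e' by rewrite divr_gt0// mulr_gt0.
have [C C0 hC] := bounded_continuous_modulus f M cf fM e' e'0.
near=> n.
rewrite -[expect_f_Hn p n f]/(expect p n (fun xi => f (Hn p xi))) -expectB.
apply: le_trans (normr_expect _ _ hp0 hp1 _) _.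
apply: le_trans (le_expect _ _ hp0 hp1 _ _ (fun xi => hC (Hn p xi) (Gn n xi))) _.
rewrite expectD !expectZ expectD expect_cst.
have h1 := expect_Hn2_le n.
have h2 : C * expect p n (fun xi => (Hn p xi - Gn n xi) ^+ 2) <= e / 2.
  have : expect p n (fun xi => (Hn p xi - Gn n xi) ^+ 2) <= e / (2 * (1 + C)).
    apply: le_trans (ler_norm _) _; near: n.
    apply: cvgr0_norm_le; first exact: expect_HnBGn2_cvg.
    by rewrite divr_gt0// mulr_gt0// ltr_pwDl.
  move=> h; apply: le_trans (ler_wpM2l C0 h) _.
  have C1 : 0 < 1 + C by rewrite ltr_pwDl.
  rewrite (_ : C * (e / (2 * (1 + C))) = e / 2 * (C / (1 + C))); last by field; rewrite gt_eqF.
  by rewrite ler_piMr ?divr_ge0 ?(ltW e0)// ler_pdivrMr// mul1r lerDr.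
have h3 : e' * (1 + expect p n (fun xi => Hn p xi ^+ 2)) <= e / 2.
  apply: (@le_trans _ _ (e' * (1 + expR q))).
    by apply: ler_wpM2l; [exact: ltW|rewrite lerD2l].
  by rewrite /e' le_eqVlt; apply/orP; left; apply/eqP; field; rewrite gt_eqF.
lra.
Unshelve. all: by end_near. Qed.

End moments.

(** * Lindeberg replacement with the heat kernel *)

Section heat_kernel.
Context {R : realType}.
Implicit Types t x y a : R.

(* [sqrt (2 * pi)] times the centred normal density of variance [t]; [hk1],
   [hk2] and [hk3] are its derivatives in [x]. *)
Definition hk t x : R := expR (- (ln t / 2) - x ^+ 2 / (2 * t)).
Definition hk1 t x : R := - (x / t) * hk t x.
Definition hk2 t x : R := (x ^+ 2 / t ^+ 2 - t^-1) * hk t x.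
Definition hk3 t x : R := (3 * x / t ^+ 2 - x ^+ 3 / t ^+ 3) * hk t x.

(** The heat equation: the derivative of [hk] in the variance is half of [hk2], so moving variance
    and position together involves only space derivatives. *)
Lemma is_derive_hk_path (T X : R -> R) (s dT dX : R) : 0 < T s ->
  is_derive s 1 T dT -> is_derive s 1 X dX ->
  is_derive s 1 (fun z => hk (T z) (X z))
    (dT / 2 * hk2 (T s) (X s) + dX * hk1 (T s) (X s)).
Proof.
move=> Ts hT hX.
have Ts0 : T s != 0 by rewrite gt_eqF.
eapply is_derive_eq.
  apply (@is_derive1_comp R expR
    (fun z => - (ln (T z) / 2) - X z ^+ 2 / (2 * T z))).
    exact: is_derive_expR.
  apply is_derive_add.
    apply is_derive_opp, is_derive_mul; last exact: is_derive_cst.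
    apply (@is_derive1_comp R (@ln R) T); last exact: hT.
    exact: is_derive1_ln.
  apply is_derive_opp, is_derive_mul; first by apply is_derive_sqr, hX.
  apply is_deriveV; first by rewrite mulf_neq0.
  by apply is_derive_mul; [exact: is_derive_cst|exact: hT].
rewrite /hk1 /hk2 -/(hk (T s) (X s)) -[_ *: _]/(_ * _) /=.
by field.
Qed.

Lemma is_derive_hk t x : 0 < t -> is_derive x 1 (hk t) (hk1 t x).
Proof.
move=> t0; eapply is_derive_eq.
  exact: (is_derive_hk_path (fun=> t) id x 0 1).
by rewrite mul0r mul0r add0r mul1r.
Qed.

Lemma is_derive_hk1 t x : 0 < t -> is_derive x 1 (hk1 t) (hk2 t x).
Proof.
move=> t0; have t1 : t != 0 by rewrite gt_eqF.
eapply is_derive_eq.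
  apply is_derive_mul; last exact: is_derive_hk.
  by apply is_derive_opp, is_derive_mul; [exact: is_derive_id|exact: is_derive_cst].
by rewrite /hk2 /hk1; field.
Qed.

Lemma is_derive_hk2 t x : 0 < t -> is_derive x 1 (hk2 t) (hk3 t x).
Proof.
move=> t0; have t1 : t != 0 by rewrite gt_eqF.
eapply is_derive_eq.
  apply is_derive_mul; last exact: is_derive_hk.
  apply is_derive_add; last exact: is_derive_cst.
  apply is_derive_mul; last exact: is_derive_cst.
  by apply is_derive_sqr, is_derive_id.
by rewrite /hk3 /hk1; field.
Qed.

Definition hk3_bound a : R :=
  expR (- (ln a / 2)) * (3 / a ^+ 2 + 14 / a + (a ^+ 3)^-1).

(** With z = x^2 / (2 t), the polynomial factors are bounded through |x| <= 1 + x^2 and |x|^3 <= 1 +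
    x^4, and exp (- z) absorbs the powers of z: z exp (- z) <= 1 and z^2 exp (- z) <= 2. *)
Lemma hk3_le a t x : 0 < a -> a <= t -> `|hk3 t x| <= hk3_bound a.
Proof.
move=> a0 at_; have t0 : 0 < t := lt_le_trans a0 at_.
have t1 : t != 0 by rewrite gt_eqF.
rewrite /hk3 normrM [`|hk t x|]ger0_norm ?expR_ge0// /hk expRD mulrCA.
rewrite /hk3_bound ler_pM ?expR_ge0 ?mulr_ge0//.
  by rewrite ler_expR lerN2 ler_pM2r ?invr_gt0// ler_ln ?posrE.
pose z := x ^+ 2 / (2 * t).
have z0 : 0 <= z by rewrite divr_ge0 ?sqr_ge0 ?mulr_ge0 ?ltW.
have xz : x ^+ 2 = 2 * t * z by rewrite /z mulrC divfK// mulf_neq0.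
have e1 : expR (- z) <= 1 by rewrite expR_le1 oppr_le0.
have ez y : y <= expR z -> y * expR (- z) <= 1.
  by move=> h; rewrite expRN ler_pdivrMr ?expR_gt0// mul1r.
have e2 : z * expR (- z) <= 1.
  by apply: ez; have := expR_ge1Dx z; lra.
have e3 : z ^+ 2 * expR (- z) <= 2.
  have : z ^+ 2 / 2 * expR (- z) <= 1.
    by apply: ez; have := expR_ge1Dxn 1 z0; rewrite -[2`!]/2%N; lra.
  lra.
have e0 := expR_ge0 (- z).
rewrite -/z.
have x1 : `|x| <= 1 + 2 * t * z.
  by rewrite -xz -real_normK ?num_real//; have := normr_ge0 x; nra.
have x3 : `|x| ^+ 3 <= 1 + 4 * t ^+ 2 * z ^+ 2.
  have -> : 4 * t ^+ 2 * z ^+ 2 = `|x| ^+ 4.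
    by rewrite -[4%N]/(2 * 2)%N exprM real_normK ?num_real// xz; ring.
  have := normr_ge0 x; move: `|x| => y y0.
  have [y1|y1] := leP y 1.
    by rewrite -[leLHS]addr0 lerD ?exprn_ge0// exprn_ile1.
  by rewrite [y ^+ 4]exprS -[leLHS]add0r lerD// ler_peMl ?exprn_ge0// ltW.
have at1 : t^-1 <= a^-1 by rewrite lef_pV2 ?posrE.
have ti0 : 0 < t^-1 by rewrite invr_gt0.
apply: (@le_trans _ _ ((3 * (1 + 2 * t * z) / t ^+ 2 +
    (1 + 4 * t ^+ 2 * z ^+ 2) / t ^+ 3) * expR (- z))).
  rewrite ler_wpM2r//; apply: le_trans (ler_normB _ _) _.
  have tn k : 0 <= (t ^+ k)^-1 by rewrite invr_ge0 exprn_ge0// ltW.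
  apply: lerD; rewrite normrM (ger0_norm (tn _)) ler_wpM2r//.
    by rewrite normrM [`|3|]ger0_norm// ler_wpM2l.
  by rewrite normrX.
(* The constant is 14 = 6 * 1 + 4 * 2, from the terms in z and in z^2. *)
apply: (@le_trans _ _ (3 * t^-1 ^+ 2 + 14 * t^-1 + t^-1 ^+ 3)).
  have -> : (3 * (1 + 2 * t * z) / t ^+ 2 +
    (1 + 4 * t ^+ 2 * z ^+ 2) / t ^+ 3) * expR (- z) =
    3 * t^-1 ^+ 2 * expR (- z) + t^-1 ^+ 3 * expR (- z) +
    (6 * t^-1 * (z * expR (- z)) + 4 * t^-1 * (z ^+ 2 * expR (- z))) by field.
  have h1 : 3 * t^-1 ^+ 2 * expR (- z) <= 3 * t^-1 ^+ 2.
    by rewrite ler_piMr// mulr_ge0// exprn_ge0// ltW.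
  have h2 : t^-1 ^+ 3 * expR (- z) <= t^-1 ^+ 3.
    by rewrite ler_piMr// exprn_ge0// ltW.
  have h3 : t^-1 * (z * expR (- z)) <= t^-1 by rewrite ler_piMr// ltW.
  have h4 : t^-1 * (z ^+ 2 * expR (- z)) <= t^-1 * 2 by rewrite ler_pM2l.
  lra.
rewrite -!exprVn !lerD//.
- by rewrite ler_wpM2l// lerXn2r ?nnegrE ?invr_ge0 ?(ltW t0) ?(ltW a0).
- by rewrite ler_wpM2l.
- by rewrite lerXn2r ?nnegrE ?invr_ge0 ?(ltW t0) ?(ltW a0).
Qed.

Lemma hk2_lip a t x y : 0 < a -> a <= t ->
  `|hk2 t (x + y) - hk2 t x| <= hk3_bound a * `|y|.
Proof.
move=> a0 at_.
have [c _] := mean_value (hk2 t) (hk3 t) x (x + y)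
  (fun z => is_derive_hk2 t z (lt_le_trans a0 at_)).
rewrite addrAC subrr add0r => ->; rewrite normrM ler_wpM2r//.
exact: hk3_le.
Qed.

Lemma hk1_taylor a t x y : 0 < a -> a <= t ->
  `|hk1 t (x + y) - hk1 t x - y * hk2 t x| <= hk3_bound a * `|y| ^+ 2.
Proof.
move=> a0 at_.
have [c] := mean_value (hk1 t) (hk2 t) x (x + y)
  (fun z => is_derive_hk1 t z (lt_le_trans a0 at_)).
rewrite addrAC subrr add0r => cy ->.
rewrite [y * _]mulrC -mulrBl normrM expr2 mulrA ler_wpM2r//.
rewrite -[c](subrKC x); apply: le_trans (hk2_lip a t x _ a0 at_) _.
rewrite ler_wpM2l//.
by apply: le_trans (hk3_le a a 0 a0 (lexx _)).
Qed.

End heat_kernel.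

(** * Replacement of two-valued increments by Gaussian ones *)

Section lindeberg.
Context {R : realType} (p d1 d0 : R).

(** Transition operator of a random walk with two-valued steps; its iterates give expectations of
    functions of a sum of independent entries. *)
Definition bstep (f : R -> R) (x : R) : R :=
  p * f (x + d1) + (1 - p) * f (x + d0).

Hypotheses (hp0 : 0 < p) (hp1 : p < 1).
Variables (h D a : R).
Hypothesis mean0 : p * d1 + (1 - p) * d0 = 0.
Hypothesis varh : p * d1 ^+ 2 + (1 - p) * d0 ^+ 2 = h.
Hypotheses (d1D : `|d1| <= D) (d0D : `|d0| <= D) (a0 : 0 < a).

Let B : R := hk3_bound a.
Let eps : R := B * (h * D + D ^+ 3).

Let h_ge0 : 0 <= h.
Proof.
by rewrite -varh; apply: addr_ge0; apply: mulr_ge0;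
  rewrite ?sqr_ge0 ?subr_ge0// ltW.
Qed.

Let B_ge0 : 0 <= B.
Proof. by apply: le_trans (hk3_le a a 0 a0 (lexx _)). Qed.

(* The heat kernel is followed along the path that adds the fraction [s] of the
   increment while removing the fraction [s ^+ 2] of its variance. *)
Lemma bstep_hk (T x : R) : a <= T -> `|bstep (hk T) x - hk (T + h) x| <= eps.
Proof.
move=> aT.
(* At s = 0 there is no increment and variance T + h, at s = 1 the full increment and variance T.
   The square makes the variance contribute - s h [hk2] to the derivative, to be matched with the
   second-order term s d^2 [hk2] of the increment. *)
pose tau (s : R) := T + (1 - s ^+ 2) * h.
pose W (s : R) : R := p * hk (tau s) (x + s * d1) + (1 - p) * hk (tau s) (x + s * d0).
pose V (d s : R) : R := - (s * h) * hk2 (tau s) (x + s * d) + d * hk1 (tau s) (x + s * d).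
pose dW (s : R) : R := p * V d1 s + (1 - p) * V d0 s.
have tauT (s : R) : s \in `[0, 1]%R -> a <= tau s.
  rewrite in_itv/= => /andP[s0 s1]; apply: le_trans aT _.
  by rewrite lerDl mulr_ge0// subr_ge0 exprn_ile1.
have tau0 (s : R) : s \in `[0, 1]%R -> 0 < tau s.
  by move=> /tauT; exact: lt_le_trans.
have der (d s : R) : s \in `[0, 1]%R ->
    is_derive s 1 (fun s : R => hk (tau s) (x + s * d)) (V d s).
  move=> s01; eapply is_derive_eq.
    apply is_derive_hk_path; first exact: tau0.
      apply is_derive_add; first exact: is_derive_cst.
      apply is_derive_mul; last exact: is_derive_cst.
      apply is_derive_add; first exact: is_derive_cst.
      by apply is_derive_opp, is_derive_sqr, is_derive_id.
    apply is_derive_add; first exact: is_derive_cst.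
    by apply is_derive_mul; last exact: is_derive_cst; exact: is_derive_id.
  by rewrite /V /=; field.
have derW (s : R) : s \in `[0, 1]%R -> is_derive s 1 W (dW s).
  move=> s01; eapply is_derive_eq.
    by apply is_derive_add; apply is_derive_mul;
      [exact: is_derive_cst|exact: der|exact: is_derive_cst|exact: der].
  by rewrite /dW /=; ring.
have cW : {within `[0, 1], continuous W}.
  by apply: derivable_within_continuous => s s01; case: (derW s s01).
have derW' (s : R) : s \in `]0, 1[%R -> is_derive s 1 W (dW s).
  rewrite in_itv/= => /andP[s0 s1]; apply: derW.
  by rewrite in_itv/= (ltW s0) (ltW s1).
have le01 : (0 : R) <= 1 by exact: ler01.
have [s s01 E] := MVT_segment le01 derW' cW.
have -> : bstep (hk T) x - hk (T + h) x = dW s.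
  rewrite subr0 mulr1 in E; rewrite -E /W /bstep /tau.
  rewrite expr1n subrr mul0r addr0 !mul1r expr0n subr0 mul1r !mul0r addr0.
  by ring.
have aS := tauT s s01.
move: s01; rewrite in_itv/= => /andP[s0 s1].
pose X := tau s; rewrite -/X in aS.
(* Subtracting the expansion at [x] does not change the average: the [hk1] terms cancel by [mean0]
   and the [hk2] terms by [varh]. What remains is of third order. *)
pose V' (d : R) : R := - (s * h) * (hk2 X (x + s * d) - hk2 X x) +
  d * (hk1 X (x + s * d) - hk1 X x - s * d * hk2 X x).
have -> : dW s = p * V' d1 + (1 - p) * V' d0.
  rewrite /dW /V /V' -/X.
  transitivity (p * V' d1 + (1 - p) * V' d0 +
      hk1 X x * (p * d1 + (1 - p) * d0) +
      s * hk2 X x * (p * d1 ^+ 2 + (1 - p) * d0 ^+ 2 - h)).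
    by rewrite /V'; ring.
  by rewrite mean0 varh subrr !mulr0 !addr0.
have bV d : `|d| <= D -> `|V' d| <= eps.
  move=> dD; have D0 : 0 <= D := le_trans (normr_ge0 _) dD.
  have sd : `|s * d| <= D.
    by rewrite normrM ger0_norm// (le_trans _ dD)// ler_piMl.
  rewrite [leRHS]mulrDr; apply: le_trans (ler_normD _ _) _; apply: lerD.
    rewrite normrM normrN normrM (ger0_norm s0) (ger0_norm h_ge0).
    apply: le_trans (ler_wpM2l _ (hk2_lip a X x (s * d) a0 aS)) _.
      by rewrite mulr_ge0.
    rewrite -/B mulrCA ler_wpM2l// -mulrA; apply: le_trans (ler_piMl _ s1) _.
      by rewrite mulr_ge0.
    by rewrite ler_wpM2l.
  rewrite normrM; apply: le_trans (ler_wpM2l (normr_ge0 _)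
    (hk1_taylor a X x (s * d) a0 aS)) _.
  rewrite -/B mulrCA ler_wpM2l// exprS ler_pM ?exprn_ge0//.
  by rewrite expr1 ler_pM.
apply: le_trans (ler_normD _ _) _.
rewrite !normrM (gtr0_norm hp0) (@gtr0_norm _ (1 - p)) ?subr_gt0//.
apply: (@le_trans _ _ (p * eps + (1 - p) * eps)).
  by apply: lerD; apply: ler_wpM2l; rewrite ?subr_ge0 ?bV ?(ltW hp0) ?(ltW hp1).
by rewrite -mulrDl addrC subrK mul1r.
Qed.

(** [bstep] is an average, so it does not amplify the error already present, and each step adds one
    [eps]. The variance never drops below [a], hence the same [eps] serves for all steps. *)
Lemma iter_bstep_hk (N : nat) (x : R) :
  `|iter N bstep (hk a) x - hk (a + N%:R * h) x| <= N%:R * eps.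
Proof.
elim: N x => [|N IH] x.
  by rewrite /= !mul0r addr0 subrr normr0.
have aT : a <= a + N%:R * h by rewrite lerDl mulr_ge0.
rewrite iterS; set u := iter N bstep (hk a).
have -> : bstep u x - hk (a + N.+1%:R * h) x =
    (p * (u (x + d1) - hk (a + N%:R * h) (x + d1)) +
     (1 - p) * (u (x + d0) - hk (a + N%:R * h) (x + d0))) +
    (bstep (hk (a + N%:R * h)) x - hk (a + N%:R * h + h) x).
  have -> : a + N%:R * h + h = a + N.+1%:R * h by rewrite -natr1; ring.
  by rewrite /bstep; ring.
rewrite -natr1 [leRHS]mulrDl mul1r; apply: le_trans (ler_normD _ _) _.
apply: lerD; last exact: bstep_hk.
apply: le_trans (ler_normD _ _) _.
rewrite !normrM (gtr0_norm hp0) (@gtr0_norm _ (1 - p)) ?subr_gt0//.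
apply: (@le_trans _ _ (p * (N%:R * eps) + (1 - p) * (N%:R * eps))).
  by apply: lerD; apply: ler_wpM2l; rewrite ?subr_ge0 ?IH ?(ltW hp0) ?(ltW hp1).
by rewrite -mulrDl addrC subrK mul1r.
Qed.

End lindeberg.

Lemma sum_binS {R : comRingType} (N : nat) (F : nat -> R) :
  \sum_(k < N.+2) 'C(N.+1, k)%:R * F k =
  \sum_(k < N.+1) 'C(N, k)%:R * (F k + F k.+1).
Proof.
rewrite big_ord_recl/= bin0.
under eq_bigr => k _ do rewrite /= /bump/= add1n binS natrD mulrDl.
under [RHS]eq_bigr => k _ do rewrite mulrDr.
rewrite !big_split/= addrA; congr (_ + _).
rewrite [RHS]big_ord_recl/= bin0; congr (_ + _).
rewrite big_ord_recr/= bin_small// mul0r addr0.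
by apply: eq_bigr => k _; rewrite /bump/= add1n.
Qed.

Lemma iter_bstepE {R : realType} (p d1 d0 : R) (f : R -> R) (N : nat) (x : R) :
  iter N (bstep p d1 d0) f x = \sum_(k < N.+1) 'C(N, k)%:R *
    (p ^+ k * (1 - p) ^+ (N - k) * f (x + (k%:R * d1 + (N - k)%:R * d0))).
Proof.
elim: N x => [|N IH] x.
  by rewrite big_ord1/= bin0 subn0 !mul0r !addr0 !mul1r.
rewrite iterS /bstep !IH (sum_binS N (fun k => p ^+ k * (1 - p) ^+ (N.+1 - k) *
  f (x + (k%:R * d1 + (N.+1 - k)%:R * d0)))).
rewrite !big_distrr/= -big_split/=; apply: eq_bigr => k _.
rewrite subSS subSn; last by rewrite -ltnS.
rewrite !exprS -!natr1.
have -> : x + d1 + (k%:R * d1 + (N - k)%:R * d0) =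
  x + ((k%:R + 1) * d1 + (N - k)%:R * d0) by ring.
have -> : x + d0 + (k%:R * d1 + (N - k)%:R * d0) =
  x + (k%:R * d1 + ((N - k)%:R + 1) * d0) by ring.
by ring.
Qed.

(** Weight and sum depend on the matrix only through its number of ones, so grouping by that number
    gives the binomial sum of [iter_bstepE], and no order on the entries has to be chosen. *)
Lemma expect_sum_bits {R : realType} (p d1 d0 : R) (n : nat) (f : R -> R) x :
  expect p n (fun xi => f (x + \sum_k (if xi k then d1 else d0))) =
  iter (n * n)%N (bstep p d1 d0) f x.
Proof.
have cK : #|{: 'I_n * 'I_n}| = (n * n)%N by rewrite card_prod card_ord.
rewrite iter_bstepE -cK.
rewrite -(@sum_card_set _ _ (fun k => p ^+ k * (1 - p) ^+ (#|{: 'I_n * 'I_n}| - k) *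
  f (x + (k%:R * d1 + (#|{: 'I_n * 'I_n}| - k)%:R * d0)))).
rewrite /expect (reindex (fun A : {set 'I_n * 'I_n} => [ffun k => k \in A]))/=;
  last first.
  exists (fun f => [set k | f k])%SET => [A _|g _].
    by apply/setP => i; rewrite inE ffunE.
  by apply/ffunP => i; rewrite ffunE inE.
apply: eq_bigr => A _; rewrite /bern_weight.
have cC : #|[predC A]| = (#|{: 'I_n * 'I_n}| - #|A|)%N.
  by rewrite -(cardC A) addKn.
congr (_ * f (x + _)).
  under eq_bigr => k _ do rewrite ffunE.
  by rewrite (bigID (mem A))/=; congr (_ * _);
    [rewrite (eq_bigr (fun=> p)) ?prodr_const// => k -> |
     rewrite (eq_bigr (fun=> 1 - p)) ?prodr_const ?cC// => k /negbTE ->].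
under eq_bigr => k _ do rewrite ffunE.
rewrite (bigID (mem A))/=; congr (_ + _).
  by rewrite (eq_bigr (fun=> d1)) ?sumr_const ?mulr_natl// => k ->.
by rewrite (eq_bigr (fun=> d0)) ?sumr_const ?mulr_natl ?cC// => k /negbTE ->.
Qed.

(** There are n^2 steps of variance h = q / n^2 and size at most D = (1 + q) / n, so h D + D^3 is of
    order n^-3. The variances add up to exactly q. *)
Lemma expect_hk_Sn {R : realType} (p a : R) : 0 < p -> p < 1 -> 0 < a ->
  exists C, forall n x, (0 < n)%N ->
    `|expect p n (fun xi => hk a (x + Sn p n xi)) - hk (a + (1 - p) / p) x| <=
    C / n%:R.
Proof.
move=> hp0 hp1 a0; set q := (1 - p) / p.
have p0 : p != 0 by rewrite gt_eqF.
have q0 : 0 < q by rewrite divr_gt0// subr_gt0.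
exists (hk3_bound a * (q * (1 + q) + (1 + q) ^+ 3)) => n x n0.
have n0R : 0 < n%:R :> R by rewrite ltr0n.
have n1R : n%:R != 0 :> R by rewrite gt_eqF.
have -> : expect p n (fun xi => hk a (x + Sn p n xi)) =
    iter (n * n)%N (bstep p (q / n%:R) (- n%:R^-1)) (hk a) x.
  rewrite -expect_sum_bits; apply: expect_ext => xi; congr (hk _ (_ + _)).
  by apply: eq_bigr => k _; rewrite /ceta; case: ifP => _ //; rewrite mulN1r.
have m0 : p * (q / n%:R) + (1 - p) * - n%:R^-1 = 0.
  by rewrite /q; field; rewrite n1R.
have v0 : p * (q / n%:R) ^+ 2 + (1 - p) * (- n%:R^-1) ^+ 2 = q / n%:R ^+ 2.
  by rewrite /q; field; rewrite n1R.
have b1 : `|q / n%:R| <= (1 + q) / n%:R.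
  rewrite ger0_norm; last by rewrite divr_ge0// ltW.
  by rewrite ler_wpM2r ?invr_ge0// lerDr.
have b0 : `|- n%:R^-1| <= (1 + q) / n%:R.
  rewrite normrN ger0_norm ?invr_ge0// ler_peMl ?invr_ge0//.
  by rewrite lerDl ltW.
have := iter_bstep_hk _ _ _ hp0 hp1 _ _ _ m0 v0 b1 b0 a0 (n * n)%N x.
have -> : (n * n)%:R * (q / n%:R ^+ 2) = q by rewrite natrM; field; rewrite n1R.
move=> /le_trans; apply; rewrite le_eqVlt; apply/orP; left; apply/eqP.
by rewrite natrM; field; rewrite n1R.
Qed.

(** * Integration *)

Section real_integrable.
Context (d : measure_display) {T : measurableType d} {R : realType}.
Context (mu : {measure set T -> \bar R}).
Implicit Types f g : T -> R.

Lemma integrable_add f g : mu.-integrable setT (EFin \o f) ->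
  mu.-integrable setT (EFin \o g) ->
  mu.-integrable setT (EFin \o (fun x => f x + g x)).
Proof. by move=> hf hg; exact: (integrableD measurableT hf hg). Qed.

Lemma integrable_sub f g : mu.-integrable setT (EFin \o f) ->
  mu.-integrable setT (EFin \o g) ->
  mu.-integrable setT (EFin \o (fun x => f x - g x)).
Proof. by move=> hf hg; exact: (integrableB measurableT hf hg). Qed.

Lemma integrable_scale (k : R) f : mu.-integrable setT (EFin \o f) ->
  mu.-integrable setT (EFin \o (fun x => k * f x)).
Proof. by move=> hf; exact: (integrableZl measurableT k hf). Qed.

Lemma integrable_bounded_mul (M : R) f g : measurable_fun setT g ->
  (forall x, `|g x| <= M) -> mu.-integrable setT (EFin \o f) ->
  mu.-integrable setT (EFin \o (fun x => g x * f x)).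
Proof.
move=> mg gM hf.
apply: (le_integrable measurableT _ _ (integrable_scale M f hf)).
  apply/measurable_EFinP/measurable_funM => //.
  by apply/measurable_EFinP; exact: measurable_int hf.
move=> x _ /=; rewrite lee_fin !normrM ler_wpM2r//.
exact: le_trans (ler_norm _).
Qed.

Lemma Rintegral_sum (I : finType) (w : I -> R) (F : I -> T -> R) :
  (forall i, mu.-integrable setT (EFin \o F i)) ->
  mu.-integrable setT (EFin \o (fun x => \sum_i w i * F i x)) /\
  \int[mu]_x (\sum_i w i * F i x) = \sum_i w i * \int[mu]_x F i x.
Proof.
move=> hF.
have h (s : seq I) :
  mu.-integrable setT (EFin \o (fun x => \sum_(i <- s) w i * F i x)) /\
  \int[mu]_x (\sum_(i <- s) w i * F i x) = \sum_(i <- s) w i * \int[mu]_x F i x.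
  elim: s => [|i s [IH1 IH2]].
    rewrite big_nil; under eq_fun do rewrite big_nil.
    split; first exact: integrable0.
    by rewrite /Rintegral integral0.
  rewrite big_cons; under [X in EFin \o X]eq_fun do rewrite big_cons.
  under [X in Rintegral _ _ X]eq_fun do rewrite big_cons.
  split; first by apply: integrable_add => //; exact: integrable_scale.
  rewrite RintegralD// ?IH2 ?RintegralZl//; exact: integrable_scale.
exact: h.
Qed.

(* Scheffe: [|v - u| = 2 (u - v)^+ + (v - u)], where the first term is dominated
   by the limit density and the second one has zero integral. *)
Lemma scheffe (rho_ : nat -> T -> R) (rho g : T -> R) (M : R) :
  (forall n x, 0 <= rho_ n x) ->
  (forall n, mu.-integrable setT (EFin \o rho_ n)) ->
  mu.-integrable setT (EFin \o rho) ->
  (forall n, \int[mu]_x rho_ n x = \int[mu]_x rho x) ->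
  (forall x, rho_ n x @[n --> \oo] --> rho x) ->
  measurable_fun setT g -> (forall x, `|g x| <= M) ->
  \int[mu]_x (g x * rho_ n x) @[n --> \oo] --> \int[mu]_x (g x * rho x).
Proof.
move=> rho0 irho_ irho int_eq rho_cvg mg gM.
(* The positive part of rho - rho_n. *)
pose pos n x := 2^-1 * (`|rho x - rho_ n x| + (rho x - rho_ n x)).
have ipos n : mu.-integrable setT (EFin \o pos n).
  apply: integrable_scale; apply: integrable_add; last exact: integrable_sub.
  by apply: integrable_norm; exact: integrable_sub.
have pos_cvg : \int[mu]_x pos n x @[n --> \oo] --> 0.
  have [|||||_ _] := @dominated_convergence _ _ _ mu setT measurableT
      (fun n => EFin \o pos n) (cst 0%E) (EFin \o (fun x => `|rho x|)).
  - by move=> n; exact: measurable_int (ipos n).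
  - exact: measurable_cst.
  - apply: aeW => x _ /=; apply: cvg_EFin; first exact: nearW.
    have -> : 0 = 2^-1 * (`|rho x - rho x| + (rho x - rho x)) :> R.
      by rewrite subrr normr0 addr0 mulr0.
    rewrite /comp/=; apply: cvgM; first exact: cvg_cst.
    have h : rho x - rho_ n x @[n --> \oo] --> rho x - rho x.
      by apply: cvgB => //; exact: cvg_cst.
    by apply: cvgD => //; exact: cvg_norm.
  - exact: integrable_norm.
  - apply: aeW => x n _ /=; rewrite lee_fin.
    have r0 := rho0 n x; rewrite /pos normrM ger0_norm ?invr_ge0//.
    have [h|h] := leP 0 (rho x - rho_ n x).
      rewrite (ger0_norm h) (ger0_norm (addr_ge0 h h)).
      by apply: le_trans (ler_norm _); lra.
    by rewrite (ltr0_norm h) addrC subrr normr0 mulr0.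
  rewrite integral0 => h; exact: fine_cvg h.
have bound n : `|\int[mu]_x (g x * rho_ n x) - \int[mu]_x (g x * rho x)| <=
    2 * M * \int[mu]_x pos n x.
  have i1 := integrable_bounded_mul M _ _ mg gM (irho_ n).
  have i2 := integrable_bounded_mul M _ _ mg gM irho.
  have ic := integrable_sub _ _ (irho_ n) irho.
  have ia := integrable_scale (2 * M) _ (ipos n).
  have ib := integrable_scale M _ ic.
  rewrite -RintegralB//.
  apply: le_trans (le_normr_Rintegral _ _) _ => //; first exact: integrable_sub.
  (* The added term has zero integral and turns the integrand into exactly M |rho - rho_n|. *)
  have -> : 2 * M * \int[mu]_x pos n x =
      \int[mu]_x (2 * M * pos n x + M * (rho_ n x - rho x)).
    rewrite (RintegralD measurableT ia ib) (RintegralZl _ measurableT (ipos n)).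
    rewrite (RintegralZl _ measurableT ic).
    by rewrite (RintegralB measurableT (irho_ n) irho) int_eq subrr mulr0 addr0.
  apply: le_Rintegral => //.
  - by apply: integrable_norm; exact: integrable_sub.
  - exact: integrable_add.
  - move=> x _; rewrite -mulrBr normrM /pos distrC.
    have -> : 2 * M * (2^-1 * (`|rho x - rho_ n x| + (rho x - rho_ n x))) +
        M * (rho_ n x - rho x) = M * `|rho x - rho_ n x| by field.
    by rewrite ler_wpM2r.
have lim0 : \int[mu]_x (g x * rho_ n x) - \int[mu]_x (g x * rho x)
    @[n --> \oo] --> 0.
  apply/cvgr0Pnorm_le => e e0; near=> n.
  apply: le_trans (bound n) _; apply: le_trans (ler_norm _) _; near: n.
  apply: cvgr0_norm_le => //; rewrite -(mulr0 (2 * M)).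
  by apply: cvgM => //; exact: cvg_cst.
have := cvgD lim0 (cvg_cst (\int[mu]_x (g x * rho x))).
rewrite add0r => h; apply: near_eq_cvgn (h _ _); apply: nearW => n.
by rewrite /= subrK.
Unshelve. all: by end_near. Qed.

End real_integrable.

(** * Normal densities and Gaussian smoothing *)

Section normal.
Context {R : realType}.
Local Notation mu := (@lebesgue_measure R).
Implicit Types (f g : R -> R) (m s x a t M : R).

Lemma integrable_normal_pdfM m s M g : measurable_fun setT g ->
  (forall x, `|g x| <= M) ->
  mu.-integrable setT (EFin \o (fun x => g x * normal_pdf m s x)).
Proof.
move=> mg gM; apply: (integrable_bounded_mul _ mu M _ _ mg gM).
exact: integrable_normal_pdf.
Qed.

Lemma Rintegral_normal_pdf m s : \int[mu]_x normal_pdf m s x = 1.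
Proof. by rewrite /Rintegral integral_normal_pdf. Qed.

(** The Radon-Nikodym derivative of the normal law agrees almost everywhere with [normal_pdf], since
    both have the same integral over every measurable set. *)
Lemma integral_normal_prob m s M g : measurable_fun setT g ->
  (forall x, `|g x| <= M) ->
  (\int[normal_prob m s]_x (g x)%:E)%E =
  (\int[mu]_x (g x * normal_pdf m s x))%:E.
Proof.
move=> mg gM.
have ig : (normal_prob m s).-integrable setT (EFin \o g).
  apply: (@measurable_bounded_integrable _ _ _ (normal_prob m s)) => //.
    by rewrite -ge0_fin_numE// fin_num_measure.
  exists M; split; first exact: num_real.
  by move=> x Mx y _ /=; apply: le_trans (gM y) (ltW Mx).
rewrite /Rintegral fineK; last first.
  by apply: (integrable_fin_num measurableT); exact: integrable_normal_pdfM gM.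
rewrite -(Radon_Nikodym_change_of_variables (normal_prob_dominates m s))//=.
under [RHS]eq_integral do rewrite EFinM.
apply: ae_eq_integral => //.
- apply: emeasurable_funM; first exact/measurable_EFinP.
  apply: (measurable_int mu).
  by apply: Radon_Nikodym_integrable; exact: normal_prob_dominates.
- apply: emeasurable_funM; apply/measurable_EFinP => //.
  exact: measurable_normal_pdf.
- apply: ae_eqe_mul2l => /=.
  rewrite Radon_NikodymE//=; first exact: normal_prob_dominates.
  move=> dom; case: cid => /= h [h1 h2 h3].
  apply: integral_ae_eq => //=.
  + by apply/measurable_EFinP; exact: measurable_normal_pdf.
  + by move=> E _ mE; rewrite -h3.
Qed.

Lemma expR_ln_half t : 0 < t -> expR (ln t / 2) = Num.sqrt t.
Proof.
move=> t0; rewrite -[in RHS](lnK t0) (_ : ln t = ln t / 2 + ln t / 2).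
  by rewrite expRD -expr2 sqrtr_sqr ger0_norm ?expR_ge0// -splitr.
exact: splitr.
Qed.

Lemma normal_pdf_hk m t x : 0 < t ->
  normal_pdf m (Num.sqrt t) x = (Num.sqrt (pi *+ 2))^-1 * hk t (x - m).
Proof.
move=> t0; rewrite normal_pdfE ?gt_eqF ?sqrtr_gt0// /normal_peak /normal_fun.
rewrite sqr_sqrtr ?ltW// -mulrnAr sqrtrM ?ltW// invfM /hk expRD.
rewrite [expR (- (ln t / 2))]expRN expR_ln_half// -[t *+ 2]mulr_natl mulNr.
by rewrite mulrA [_ * (Num.sqrt t)^-1]mulrC.
Qed.

Lemma hk_even t x : hk t (- x) = hk t x.
Proof. by rewrite /hk sqrrN. Qed.

(** Half of the Gaussian exponent absorbs x^2, which bounds a second moment by the total mass of a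
    wider normal law. Here 8 = 4 * 2: x^2 = 4 a z, z exp (- z) <= 1, and the ratio of
    normalizations, the square root of 2, is at most 2. *)
Lemma sqr_hk_le a x : 0 < a -> x ^+ 2 * hk a x <= 8 * a * hk (2 * a) x.
Proof.
move=> a0; have a1 : a != 0 by rewrite gt_eqF.
have l2 : expR (ln 2 / 2) <= 2 :> R.
  rewrite -[leRHS](@lnK R 2) ?posrE// ler_expR.
  have : 0 <= ln 2 :> R by rewrite ln_ge0// ler1n.
  lra.
pose z := x ^+ 2 / (2 * (2 * a)).
have xz : x ^+ 2 = 4 * a * z by rewrite /z; field.
have ha : hk a x = expR (ln 2 / 2) * hk (2 * a) x * expR (- z).
  rewrite /hk -!expRD lnM ?posrE//; congr expR; rewrite /z; field.
  by rewrite a1.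
have zz : z * expR (- z) <= 1.
  rewrite expRN ler_pdivrMr ?expR_gt0// mul1r.
  by have := expR_ge1Dx z; lra.
have z0 : 0 <= z by rewrite /z divr_ge0 ?sqr_ge0// !mulr_ge0// ltW.
rewrite ha xz (_ : _ * _ = 4 * a * (expR (ln 2 / 2) * (z * expR (- z))) *
  hk (2 * a) x); last by ring.
rewrite ler_wpM2r ?expR_ge0//.
rewrite (_ : 8 * a = 4 * a * (2 * 1)); last by ring.
rewrite ler_pM2l ?mulr_gt0// ler_pM ?expR_ge0// mulr_ge0// expR_ge0.
Qed.

(** Convolution of [g] with a normal law, with [x] placed in the density: averaging over [x] then
    acts on the density alone. *)
Definition gauss_conv a g x : R := \int[mu]_c (g c * normal_pdf x (Num.sqrt a) c).

(** The weight 1 + x^2 of the modulus is constant under the integral, and (x - c)^2 integrates to at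
    most 8 a by [sqr_hk_le]. *)
Lemma gauss_conv_error a g M (e C : R) x : 0 < a -> 0 <= C ->
  measurable_fun setT g -> (forall x, `|g x| <= M) ->
  (forall x y, `|g x - g y| <= e * (1 + x ^+ 2) + C * (x - y) ^+ 2) ->
  `|g x - gauss_conv a g x| <= e * (1 + x ^+ 2) + 8 * a * C.
Proof.
move=> a0 C0 mg gM gC.
pose r c := normal_pdf x (Num.sqrt a) c.
pose r2 c := normal_pdf x (Num.sqrt (2 * a)) c.
have ir : mu.-integrable setT (EFin \o r) by exact: integrable_normal_pdf.
have ir2 : mu.-integrable setT (EFin \o r2) by exact: integrable_normal_pdf.
have igr := integrable_normal_pdfM x (Num.sqrt a) M g mg gM.
have i1 := integrable_scale _ mu (g x) _ ir.
have i2 := integrable_sub _ mu _ _ i1 igr.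
have i3 := integrable_add _ mu _ _ (integrable_scale _ mu (e * (1 + x ^+ 2)) _ ir)
  (integrable_scale _ mu (8 * a * C) _ ir2).
have -> : g x - gauss_conv a g x =
    \int[mu]_c (g x * r c - g c * normal_pdf x (Num.sqrt a) c).
  rewrite (RintegralB measurableT i1 igr) (RintegralZl _ measurableT ir).
  by rewrite Rintegral_normal_pdf mulr1.
apply: le_trans (le_normr_Rintegral measurableT i2) _.
apply: (@le_trans _ _ (\int[mu]_c (e * (1 + x ^+ 2) * r c + 8 * a * C * r2 c))).
  apply: le_Rintegral => //; first exact: integrable_norm.
  move=> c _; rewrite -/(r c) -mulrBl normrM [`|r c|]ger0_norm ?normal_pdf_ge0//.
  apply: le_trans (ler_wpM2r (normal_pdf_ge0 _ _ _) (gC x c)) _.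
  rewrite mulrDl lerD2l /r /r2 !normal_pdf_hk ?mulr_gt0//.
  have := sqr_hk_le a (c - x) a0.
  rewrite -(sqrrN (c - x)) opprB => h.
  rewrite (_ : C * _ * _ = C * (Num.sqrt (pi *+ 2))^-1 *
    ((x - c) ^+ 2 * hk a (c - x))); last by ring.
  rewrite (_ : 8 * a * C * _ = C * (Num.sqrt (pi *+ 2))^-1 *
    (8 * a * hk (2 * a) (c - x))); last by ring.
  by rewrite ler_wpM2l// mulr_ge0// invr_ge0 sqrtr_ge0.
rewrite RintegralD//; try exact: integrable_scale.
rewrite (RintegralZl _ measurableT ir) (RintegralZl _ measurableT ir2).
by rewrite !Rintegral_normal_pdf !mulr1.
Qed.

End normal.

(** * Central limit theorem *)

Section clt.
Context {R : realType} (p : R).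
Hypotheses (hp0 : 0 < p) (hp1 : p < 1).
Local Notation mu := (@lebesgue_measure R).
Local Notation q := ((1 - p) / p).

Let q_gt0 : 0 < q. Proof. by rewrite divr_gt0// subr_gt0. Qed.

Definition Yn (n : nat) (xi : bmatrix n) : R := Sn p n xi - q / 2.

Lemma sqr_le_expR (x : R) : x ^+ 2 <= 2 * (expR x + expR (- x)).
Proof.
have h (y : R) : 0 <= y -> y ^+ 2 <= 2 * expR y.
  by move=> y0; have := expR_ge1Dxn 1 y0; rewrite -[2`!]/2%N; lra.
have e1 := expR_ge0 x; have e2 := expR_ge0 (- x).
have [x0|x0] := leP 0 x; first by have := h x x0; lra.
have := h (- x); rewrite sqrrN oppr_ge0 (ltW x0) => /(_ isT); lra.
Qed.

(** The second moment is dominated by the exponential moments at 1 and - 1, whose limits are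
    known. *)
Lemma expect_Yn2_bounded : exists2 K, 0 <= K &
  \forall n \near \oo, expect p n (fun xi => Yn n xi ^+ 2) <= K.
Proof.
pose v n := 2 * (expR (- (q / 2)) * expect p n (fun xi => expR (1 * Sn p n xi)) +
  expR (q / 2) * expect p n (fun xi => expR (- 1 * Sn p n xi))).
pose l := 2 * (expR (- (q / 2)) * expR (q / 2 * 1 ^+ 2) +
  expR (q / 2) * expR (q / 2 * (- 1) ^+ 2)).
have vl : v @ \oo --> l.
  apply: cvgM; first exact: cvg_cst.
  by apply: cvgD; apply: cvgM; first [exact: cvg_cst|exact: expect_expR_Sn_cvg].
exists (l + 1).
  by rewrite addr_ge0// mulr_ge0// addr_ge0// mulr_ge0// expR_ge0.
near=> n.
have vn : v n <= l + 1.
  have : `|l - v n| <= 1 by near: n; apply: cvgr_dist_le.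
  by rewrite ler_norml => /andP[? ?]; lra.
apply: le_trans vn; rewrite /v -!expectZ -expectD -expectZ.
apply: le_expect => // xi; apply: le_trans (sqr_le_expR _) _.
rewrite le_eqVlt; apply/orP; left; apply/eqP; congr (_ * _).
by rewrite -!expRD /Yn; congr (expR _ + expR _); ring.
Unshelve. all: by end_near. Qed.

Lemma expect_gauss_conv_cvg (a M : R) (g : R -> R) : 0 < a ->
  measurable_fun setT g -> (forall x, `|g x| <= M) ->
  expect p n (fun xi => gauss_conv a g (Yn n xi)) @[n --> \oo] -->
  \int[mu]_c (g c * normal_pdf (- (q / 2)) (Num.sqrt (a + q)) c).
Proof.
move=> a0 mg gM.
(* Density of [Yn] plus an independent noise of variance [a]: a finite mixture of normal
   densities. *)
pose rho_ n c := expect p n (fun xi => normal_pdf (Yn n xi) (Num.sqrt a) c).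
have rho_int n : mu.-integrable setT (EFin \o rho_ n) /\ \int[mu]_c rho_ n c = 1.
  have [] := @Rintegral_sum _ _ _ mu (bmatrix n) (bern_weight p (n:=n))
    (fun xi c => normal_pdf (Yn n xi) (Num.sqrt a) c).
    by move=> xi; exact: integrable_normal_pdf.
  move=> h1 h2; split => //; rewrite h2 -[RHS](expect_cst p n).
  by apply: eq_bigr => xi _; rewrite Rintegral_normal_pdf.
apply: (@near_eq_cvgn _ (fun n => \int[mu]_c (g c * rho_ n c))).
  apply: nearW => n.
  have [] := @Rintegral_sum _ _ _ mu (bmatrix n) (bern_weight p (n:=n))
    (fun xi c => g c * normal_pdf (Yn n xi) (Num.sqrt a) c).
    by move=> xi; exact: integrable_normal_pdfM gM.
  move=> _ h; rewrite [RHS](esym h); apply: eq_Rintegral => c _.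
  by rewrite /rho_ /expect big_distrr/=; apply: eq_bigr => xi _; ring.
apply: (@scheffe _ _ _ mu _ _ _ M) => //.
- move=> n c; apply: sumr_ge0 => xi _.
  by rewrite mulr_ge0 ?normal_pdf_ge0// bern_weight_ge0.
- by move=> n; case: (rho_int n).
- exact: integrable_normal_pdf.
- by move=> n; case: (rho_int n) => _ ->; rewrite Rintegral_normal_pdf.
move=> c; have [C hC] := expect_hk_Sn p a hp0 hp1 a0.
have aq : 0 < a + q by rewrite addr_gt0.
(* By evenness of the kernel, c - [Yn] may be replaced by [Yn] - c, which is [x] plus [Sn] as in
   [expect_hk_Sn]. *)
pose x := - (q / 2) - c; pose k0 : R := (Num.sqrt (pi *+ 2))^-1.
have -> : normal_pdf (- (q / 2)) (Num.sqrt (a + q)) c = k0 * hk (a + q) x.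
  by rewrite normal_pdf_hk// -hk_even opprB.
apply: (@near_eq_cvgn _ (fun n => k0 * expect p n (fun xi => hk a (x + Sn p n xi)))).
  apply: nearW => n; rewrite -expectZ; apply: expect_ext => xi.
  rewrite normal_pdf_hk// -hk_even; congr (_ * hk _ _).
  by rewrite /x /Yn; ring.
apply: cvgM; first exact: cvg_cst.
apply: (@cvg_invn_rate _ _ _ C); near=> n; apply: hC.
by near: n; exact: nbhs_infty_gt.
Unshelve. all: by end_near. Qed.

(** Continuity in the variance follows from differentiability along a path with fixed position. *)
Lemma normal_pdf_var_cvg (m c : R) :
  normal_pdf m (Num.sqrt (k.+1%:R^-1 + q)) c @[k --> \oo] -->
  normal_pdf m (Num.sqrt q) c.
Proof.
have hder : is_derive q 1 (fun t => hk t (c - m))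
    (1 / 2 * hk2 q (c - m) + 0 * hk1 q (c - m)).
  exact: (is_derive_hk_path id (fun=> c - m) q 1 0).
have hc : {for q, continuous (fun t => hk t (c - m))}.
  by apply/differentiable_continuous/derivable1_diffP; case: hder.
rewrite normal_pdf_hk//.
under eq_fun do rewrite normal_pdf_hk ?addr_gt0 ?invr_gt0 ?ltr0n//.
apply: cvgM; first exact: cvg_cst.
have h0 : k.+1%:R^-1 + q @[k --> \oo] --> q.
  rewrite -[X in _ --> X]add0r; apply: cvgD; last exact: cvg_cst.
  exact: cvg_harmonic.
exact: (cvg_comp _ _ h0 hc).
Qed.

Lemma clt_Yn (g : R -> R) (M : R) : continuous g -> (forall x, `|g x| <= M) ->
  expect p n (fun xi => g (Yn n xi)) @[n --> \oo] -->
  \int[mu]_c (g c * normal_pdf (- (q / 2)) (Num.sqrt q) c).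
Proof.
move=> cg gM; have mg : measurable_fun setT g by exact: continuous_measurable_fun.
set L := Rintegral _ _ _.
have [K K0 hK] := expect_Yn2_bounded.
have K1 : 0 < 1 + K by rewrite ltr_pwDl.
apply/cvgrPdist_le => e e0.
(* Makes e1 (1 + K) = e / 4, one of four quarters of [e]: two for smoothing g under the law of [Yn],
   one for the limit n to infinity, one for removing the noise from the limit law. *)
pose e1 := e / (4 * (1 + K)).
have e10 : 0 < e1 by rewrite divr_gt0// mulr_gt0.
have e4 : 0 < e / 4 by rewrite divr_gt0.
have [C C0 hC] := bounded_continuous_modulus g M cg gM e1 e10.
pose La a := \int[mu]_c (g c * normal_pdf (- (q / 2)) (Num.sqrt (a + q)) c).
have La_cvg : La k.+1%:R^-1 @[k --> \oo] --> L.
  apply: (@scheffe _ _ _ mu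
    (fun k c => normal_pdf (- (q / 2)) (Num.sqrt (k.+1%:R^-1 + q)) c)
    (fun c => normal_pdf (- (q / 2)) (Num.sqrt q) c) g M).
  - by move=> n x; exact: normal_pdf_ge0.
  - by move=> n; exact: integrable_normal_pdf.
  - exact: integrable_normal_pdf.
  - by move=> n; rewrite !Rintegral_normal_pdf.
  - by move=> x; exact: normal_pdf_var_cvg.
  - exact: mg.
  - exact: gM.
have aC_cvg : 8 * k.+1%:R^-1 * C @[k --> \oo] --> 0.
  rewrite -(mul0r C) -(mulr0 8); apply: cvgM; last exact: cvg_cst.
  by apply: cvgM; [exact: cvg_cst|exact: cvg_harmonic].
(* The noise level is fixed before n grows, because [hk3_bound a] is unbounded as [a] tends to 0. *)
have [k [hk1 hk2]] : exists k : nat, `|L - La k.+1%:R^-1| <= e / 4 /\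
    8 * k.+1%:R^-1 * C <= e / 4.
  near \oo => k; exists k; split.
    by near: k; exact: cvgr_dist_le.
  by apply: le_trans (ler_norm _) _; near: k; exact: cvgr0_norm_le.
have a0 : 0 < k.+1%:R^-1 :> R by rewrite invr_gt0.
move: hk1 hk2 a0; move: (k.+1%:R^-1) => a hL haC a0.
have conv := expect_gauss_conv_cvg a M g a0 mg gM.
near=> n.
have h1 : `|La a - expect p n (fun xi => gauss_conv a g (Yn n xi))| <= e / 4.
  by near: n; exact: (cvgr_dist_le _ _ conv _ e4).
have h2 : `|expect p n (fun xi => gauss_conv a g (Yn n xi)) -
    expect p n (fun xi => g (Yn n xi))| <= e / 4 + e / 4.
  rewrite distrC -expectB; apply: le_trans (normr_expect _ _ hp0 hp1 _) _.
  have hx xi := gauss_conv_error a g M e1 C (Yn n xi) a0 C0 mg gM hC.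
  apply: le_trans (le_expect _ _ hp0 hp1 _ _ hx) _.
  rewrite expectD expectZ expectD !expect_cst lerD//.
  have hKn : expect p n (fun xi => Yn n xi ^+ 2) <= K by near: n.
  apply: (@le_trans _ _ (e1 * (1 + K))).
    by apply: ler_wpM2l; [exact: ltW|rewrite lerD2l].
  by rewrite /e1 le_eqVlt; apply/orP; left; apply/eqP; field; rewrite gt_eqF.
set E' := expect p n (fun xi => gauss_conv a g (Yn n xi)) in h1 h2.
set E := expect p n (fun xi => g (Yn n xi)) in h2 *.
rewrite (_ : L - E = (L - La a) + (La a - E') + (E' - E)); last by ring.
apply: le_trans (ler_normD _ _) _.
have := ler_normD (L - La a) (La a - E'); lra.
Unshelve. all: by end_near. Qed.

End clt.

(* Weak convergence of H_n to exp(X), X ~ N(-(1-p)/(2p), (1-p)/p):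
   for every bounded continuous f, E[f(H_n)] --> E[f(exp X)].
   normal_prob m s is parametrized by the standard deviation s. *)
Theorem theorem2 (R : realType) (p : R) (hp0 : 0 < p) (hp1 : p < 1) :
  forall f : R -> R, continuous f -> (exists M : R, forall x, `|f x| <= M) ->
  (fun n => (expect_f_Hn p n f)%:E) @ \oo -->
    (\int[normal_prob (- ((1 - p) / (2 * p))) (Num.sqrt ((1 - p) / p))]_x
        (f (expR x))%:E)%E.
Proof.
move=> f cf [M fM].
have cg : continuous (f \o expR).
  by move=> x; apply: continuous_comp; [exact: continuous_expR|exact: cf].
have mg : measurable_fun setT (f \o expR) by exact: continuous_measurable_fun.
rewrite (integral_normal_prob _ _ M (f \o expR) mg (fun x => fM (expR x))).
apply: cvg_EFin; first exact: nearW.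
have -> : (1 - p) / (2 * p) = (1 - p) / p / 2 by field; rewrite gt_eqF.
apply: (@near_eq_cvgn _ (fun n =>
    (expect_f_Hn p n f - expect p n (fun xi => f (Gn p n xi))) +
    expect p n (fun xi => (f \o expR) (Yn p n xi)))).
  by apply: nearW => n; rewrite /= subrK.
rewrite -[X in _ --> X]add0r; apply: cvgD.
  exact: expect_f_HnBGn_cvg fM.
exact: (clt_Yn p hp0 hp1 (f \o expR) M cg (fun x => fM (expR x))).
Qed.
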